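(* Let $G$ be a finite abelian group with $|G|=n+1$ and let $X$ be an arbitrary set. Suppose that $G=\bigcup_{i\in\Lambda}\left(\bigcap_{x\in X}G_x^{\phi_i}\right)$, where $\Lambda$ is an index set and the $\phi_i$ ($i\in\Lambda$) are vertices of $GAS(G)$, and that $GAS(G)$ is a totally disconnected graph. Then the number of group actions of $G$ on $X$ is at most $n$.
   Context: For an action $\phi:G\times X\to X$ of $G$ on $X$, $G_x^{\phi}=\{g\in G:\phi(g,x)=x\}$ is the stabilizer of $x\in X$, and $e$ is the identity of $G$. The group action-stabilizer graph $GAS(G)$ (of $G$ on $X$) has as vertices the group actions of $G$ on $X$, and two distinct vertices $\phi,\psi$ are adjacent if and only if $\left(\bigcap_{x\in X}G_x^{\phi}\right)\cap\left(\bigcap_{x\in X}G_x^{\psi}\right)\neq\{e\}$; actions $\phi$ with $\bigcap_{x\in X}G_x^{\phi}=\{e\}$ (which would be isolated vertices) are removed from the vertex set, and ''group actions'' in the claim means the vertices of $GAS(G)$. A graph is totally disconnected if it has no edges. *)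

(* Defs.v *)
From mathcomp Require Import all_boot all_fingroup.
From mathcomp Require Import boolp classical_sets functions cardinality.

Set Implicit Arguments.
Unset Strict Implicit.
Unset Printing Implicit Defensive.

Local Open Scope classical_set_scope.

(* Simple graphs whose vertex set may be infinite. *)
Record sgraph (T : Type) := SGraph {
  vertices : set T;
  adj : T -> T -> Prop;
  adj_vertices : forall u v, adj u v -> vertices u /\ vertices v;
  adj_irrefl : forall u, ~ adj u u;
  adj_sym : forall u v, adj u v -> adj v u
}.

Definition totally_disconnected (T : Type) (Gr : sgraph T) : Prop :=
  forall u v, ~ adj Gr u v.

Section GAS.
Variables (gT : finGroupType) (X : Type).
Implicit Types phi psi : gT -> X -> X.

(* MathComp's {action gT &-> X} is a right action bundled with a proof, and its
   stabilisers require X to be finite. Here an action is the curried map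
   phi : gT -> X -> X itself, so two actions are equal iff they are equal as
   maps. *)
Definition left_action phi : Prop :=
  (forall x, phi 1%g x = x) /\
  (forall g h x, phi (g * h)%g x = phi g (phi h x)).

Definition stabilizer phi (x : X) : set gT := [set g | phi g x = x].

Definition action_kernel phi : set gT :=
  \bigcap_(x in [set: X]) stabilizer phi x.

Definition GAS_vertices : set (gT -> X -> X) :=
  [set phi | left_action phi /\ action_kernel phi <> [set 1%g]].

Definition GAS_adj phi psi : Prop :=
  [/\ GAS_vertices phi, GAS_vertices psi, phi <> psi &
      action_kernel phi `&` action_kernel psi <> [set 1%g]].

Fact GAS_adj_vertices phi psi :
  GAS_adj phi psi -> GAS_vertices phi /\ GAS_vertices psi.
Proof. by case. Qed.

Fact GAS_adj_irrefl phi : ~ GAS_adj phi phi.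
Proof. by case. Qed.

Fact GAS_adj_sym phi psi : GAS_adj phi psi -> GAS_adj psi phi.
Proof.
case=> Vphi Vpsi neq nt; split=> //; first by move=> eq; apply: neq.
by rewrite setIC.
Qed.

Definition GAS : sgraph (gT -> X -> X) :=
  SGraph GAS_adj_vertices GAS_adj_irrefl GAS_adj_sym.

End GAS.

Arguments GAS : clear implicits.

(* Main.v *)
(** In a totally disconnected graph the kernels of distinct vertices meet
    trivially, so choosing a nontrivial element of each kernel is an injection
    from the vertices into [G] minus its identity, a set with [n] elements. *)
Require Import Defs.
From mathcomp Require Import all_boot all_fingroup.
From mathcomp Require Import boolp classical_sets functions cardinality.

Local Open Scope classical_set_scope.
Local Open Scope card_scope.

Lemma action_kernel1 (gT : finGroupType) (X : Type) (psi : gT -> X -> X) :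
  left_action psi -> action_kernel psi 1%g.
Proof. by case=> psi1 _ x _; apply: psi1. Qed.

(** The kernel always contains the identity, so it can differ from [[set 1%g]] only by having a
    further element. *)
Lemma GAS_vertex_kernel_nontrivial (gT : finGroupType) (X : Type)
    (psi : gT -> X -> X) :
  GAS_vertices psi -> exists2 g, action_kernel psi g & g != 1%g.
Proof.
case=> actpsi ntpsi; apply: contrapT => triv; apply: ntpsi.
apply/seteqP; split=> [g Kg | _ ->]; last exact: action_kernel1.
by apply: contrapT => /eqP g1; apply: triv; exists g.
Qed.

(** Were the two actions distinct, [g] would make their kernels meet nontrivially and so create an
    edge. *)
Lemma totally_disconnected_kernel_inj (gT : finGroupType) (X : Type)
    (psi1 psi2 : gT -> X -> X) (g : gT) :
  totally_disconnected (GAS gT X) ->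
  GAS_vertices psi1 -> GAS_vertices psi2 ->
  action_kernel psi1 g -> action_kernel psi2 g -> g != 1%g ->
  psi1 = psi2.
Proof.
move=> tdG V1 V2 K1 K2 /eqP g1; apply: contrapT => neq.
apply: (tdG psi1 psi2); split=> // triv; apply: g1.
by have : [set 1%g] g by rewrite -triv.
Qed.

Lemma card_le_nontrivial (gT : finGroupType) (n : nat) :
  #|[set: gT]%SET| = n.+1 -> [set g : gT | g != 1%g] #<= `I_n.
Proof.
move=> cardG; set s := enum [set~ 1%g : gT]%SET.
have mem_s g : (g \in s) = (g != 1%g) by rewrite mem_enum !inE.
have size_s : size s = n by rewrite -cardE cardsC1 -cardsT cardG.
(* Positions in [s] number the non-identity elements from 0; [nth] recovers each from its position,
   never reaching the default [1%g]. *)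
have index_inj : set_inj [set g : gT | g != 1%g] (index^~ s).
  move=> g h /set_mem /= g1 /set_mem /= h1 eq_gh.
  by rewrite -(nth_index 1%g (s := s) (x := g)) ?mem_s // eq_gh nth_index ?mem_s.
rewrite -(card_le_eql (inj_card_eq index_inj)); apply: subset_card_le.
by move=> _ [g /= g1 <-]; rewrite -size_s index_mem mem_s.
Qed.

Theorem theorem3p13 (gT : finGroupType) (n : nat) (X : Type)
    (Lambda : Type) (phi : Lambda -> gT -> X -> X)
    (abelG : abelian [set: gT]%SET)
    (cardG : #|[set: gT]%SET| = n.+1)
    (phiV : forall i, vertices (GAS gT X) (phi i))
    (coverG : [set: gT] = \bigcup_(i in [set: Lambda]) action_kernel (phi i))
    (tdG : totally_disconnected (GAS gT X)) :
  vertices (GAS gT X) #<= `I_n.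
Proof.
(* [choice] yields a total function, so the vertex condition sits under the existential and
   non-vertices get the dummy [1%g]. *)
have /choice[f fP] (psi : gT -> X -> X) :
    exists g, GAS_vertices psi -> action_kernel psi g /\ g != 1%g.
  have [/GAS_vertex_kernel_nontrivial[g Kg g1] | nV] := pselect (GAS_vertices psi).
    by exists g.
  by exists 1%g.
apply: card_le_trans (card_le_nontrivial gT n cardG).
have f_inj : set_inj (vertices (GAS gT X)) f.
  move=> psi1 psi2 /set_mem V1 /set_mem V2 eq_f.
  have [K1 nt1] := fP _ V1; have [K2 _] := fP _ V2.
  by apply: (totally_disconnected_kernel_inj gT X psi1 psi2 (f psi1)); rewrite // eq_f.
(* The vertex set is equipotent to its image under [f], so it suffices that this image avoids the
   identity. *)
rewrite -(card_le_eql (inj_card_eq f_inj)); apply: subset_card_le.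
by move=> _ [psi V <-]; have [] := fP _ V.
Qed.
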